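(* For a real number $t$ let $S(t)\subset\mathbb{R}^9$ be the simplex with vertices $$(1,0,0,0,0,0,0,0,1),\ (1,1,0,1,t,1,1,0,0),\ (1,0,1,1,1-t,0,1,1,0),\ (0,1,1,1,t,0,0,1,1),$$ $$(0,1,1,0,1-t,1,0,0,0),\ (0,0,0,1,t,0,1,1,0),\ (1,1,0,0,1-t,1,1,1,0),$$ $$(0,1,1,0,t,1,1,0,1),\ (0,0,1,1,1-t,1,0,1,1),\ (1,0,0,0,1,0,0,0,1).$$ If $\frac25\le t\le\frac35$, then $S(t)$ is a nondegenerate simplex contained in $Q_9$, $\alpha(S(t))=\xi(S(t))=9$, and the simplex $9S(t)$ is circumscribed around $Q_9$. Moreover, $\xi_9=9$.
   Context: $Q_n=[0,1]^n\subset\mathbb{R}^n$. For a nondegenerate $n$-dimensional simplex $S\subset\mathbb{R}^n$ and $\sigma>0$, $\sigma S$ denotes the image of $S$ under the homothety with center at the center of gravity of $S$ (the arithmetic mean of its vertices) and coefficient $\sigma$. Put $\xi(S)=\min\{\sigma\ge 1: Q_n\subset\sigma S\}$; let $\alpha(S)$ be the minimal $\sigma>0$ such that $Q_n$ is contained in a translate of $\sigma S$; and let $$\xi_n=\min\{\xi(S): S \text{ is an } n\text{-dimensional simplex},\ S\subset Q_n,\ \mathrm{vol}(S)\neq 0\}.$$ An $n$-dimensional simplex $T$ is circumscribed around a convex body $C$ if $C\subset T$ and each $(n-1)$-dimensional face of $T$ contains a point of $C$. *)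

(* Defs.v *)
From HB Require Import structures.
From mathcomp Require Import all_boot all_order all_algebra.
From mathcomp Require Import boolp classical_sets reals.

Set Implicit Arguments.
Unset Strict Implicit.
Unset Printing Implicit Defensive.

Import Order.TTheory GRing.Theory Num.Theory.

Local Open Scope classical_set_scope.
Local Open Scope ring_scope.

(* The default value 0 is taken only by sets without a least element, so an
   equation [minimum A = m] with [m != 0] says that m is attained and is the
   least element of A. *)
Definition minimum (R : realType) (A : set R) : R :=
  xget 0 [set m | A m /\ lbound A m].

Definition cube (R : realType) (n : nat) : set 'rV[R]_n :=
  [set x | forall i, 0 <= x 0 i <= 1].

(* A simplex is given by the family of its n + 1 vertices. *)
Definition simplex (R : realType) (n : nat) (v : 'I_n.+1 -> 'rV[R]_n) :
    set 'rV[R]_n :=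
  [set x | exists l : 'I_n.+1 -> R,
    [/\ forall j, 0 <= l j, \sum_j l j = 1 & x = \sum_j l j *: v j]].

(* The (n-1)-dimensional face opposite to the vertex v i. *)
Definition facet (R : realType) (n : nat) (v : 'I_n.+1 -> 'rV[R]_n)
    (i : 'I_n.+1) : set 'rV[R]_n :=
  [set x | exists l : 'I_n.+1 -> R,
    [/\ forall j, 0 <= l j, \sum_j l j = 1, l i = 0
      & x = \sum_j l j *: v j]].

(* Affine independence of the vertices. *)
Definition nondegenerate_simplex (R : realType) (n : nat)
    (v : 'I_n.+1 -> 'rV[R]_n) : Prop :=
  forall l : 'I_n.+1 -> R,
    \sum_j l j = 0 -> \sum_j l j *: v j = 0 -> forall j, l j = 0.

(* vol(S) = |det A| / n!, where the rows of A are the (v_j, 1). *)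
Definition volume (R : realType) (n : nat) (v : 'I_n.+1 -> 'rV[R]_n) : R :=
  `|\det (\matrix_(i < n.+1, j < n.+1)
            (if unlift ord_max j is Some k then v i 0 k else 1))| / (n`!)%:R.

Definition centroid (R : realType) (n : nat) (v : 'I_n.+1 -> 'rV[R]_n) :
    'rV[R]_n :=
  n.+1%:R^-1 *: \sum_j v j.

Definition homothety (R : realType) (n : nat) (c : 'rV[R]_n) (s : R)
    (x : 'rV[R]_n) : 'rV[R]_n :=
  c + s *: (x - c).

Definition dilate (R : realType) (n : nat) (s : R)
    (v : 'I_n.+1 -> 'rV[R]_n) : set 'rV[R]_n :=
  homothety (centroid v) s @` simplex v.

Definition xi (R : realType) (n : nat) (v : 'I_n.+1 -> 'rV[R]_n) : R :=
  minimum [set s | 1 <= s /\ @cube R n `<=` dilate s v].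

Definition alpha (R : realType) (n : nat) (v : 'I_n.+1 -> 'rV[R]_n) : R :=
  minimum [set s | 0 < s /\
    exists y : 'rV[R]_n, @cube R n `<=` [set y + x | x in dilate s v]].

Definition xi_min (R : realType) (n : nat) : R :=
  minimum [set xi v | v in [set v : 'I_n.+1 -> 'rV[R]_n |
    [/\ nondegenerate_simplex v, simplex v `<=` @cube R n & volume v != 0]]].

Definition circumscribed (R : realType) (n : nat) (T C : set 'rV[R]_n) : Prop :=
  exists w : 'I_n.+1 -> 'rV[R]_n,
    [/\ nondegenerate_simplex w, T = simplex w, C `<=` T
      & forall i, (facet w i `&` C) !=set0].

Definition vertices9 (R : realType) (t : R) : seq (seq R) :=
  [:: [:: 1; 0; 0; 0; 0;     0; 0; 0; 1];
      [:: 1; 1; 0; 1; t;     1; 1; 0; 0];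
      [:: 1; 0; 1; 1; 1 - t; 0; 1; 1; 0];
      [:: 0; 1; 1; 1; t;     0; 0; 1; 1];
      [:: 0; 1; 1; 0; 1 - t; 1; 0; 0; 0];
      [:: 0; 0; 0; 1; t;     0; 1; 1; 0];
      [:: 1; 1; 0; 0; 1 - t; 1; 1; 1; 0];
      [:: 0; 1; 1; 0; t;     1; 1; 0; 1];
      [:: 0; 0; 1; 1; 1 - t; 1; 0; 1; 1];
      [:: 1; 0; 0; 0; 1;     0; 0; 0; 1]].

Definition S9 (R : realType) (t : R) (i : 'I_10) : 'rV[R]_9 :=
  \row_(j < 9) nth 0 (nth [::] (vertices9 t) i) j.

(* Main.v *)
Require Import Defs.
From HB Require Import structures.
From mathcomp Require Import all_boot all_order all_algebra.
From mathcomp Require Import boolp classical_sets reals.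
From mathcomp Require Import ring lra.

Set Implicit Arguments.
Unset Strict Implicit.
Unset Printing Implicit Defensive.

Import Order.TTheory GRing.Theory Num.Theory.

Local Open Scope classical_set_scope.
Local Open Scope ring_scope.

(** Let lambda_j be the barycentric coordinates of a nondegenerate simplex S with
vertices v_j.  They are affine functions
lambda_j(x) = sum_k b_kj x_k + b_j, whose coefficients form the inverse of the
matrix with rows (v_j, 1), so the minimum of lambda_j over the cube is
m_j = b_j + sum_k min(b_kj, 0) ([cube_min]), attained at the 0/1-point that
selects the negative coefficients.

The simplex s S is the set where every lambda_j is at least (1 - s) / (n + 1)
([dilateP]), so the cube lies in s S if and only if every
m_j >= (1 - s) / (n + 1).  This is a finite system of lower bounds on s, which
is why the minimum defining xi(S) is attained ([xi_attained]).  A translate of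
s S is similarly given by lambda_j >= c_j with sum_j c_j = 1 - s; if it contains
the cube, then s >= 1 - sum_j m_j.

Suppose S is contained in the cube.  For each k the coefficients satisfy
sum_j b_kj = 0 and sum_j b_kj (v_j)_k = 1 with 0 <= (v_j)_k <= 1, so their
positive parts have sum at least 1, and hence sum_j min(b_kj, 0) <= -1.  Since
sum_j b_j = 1, this gives sum_j m_j <= 1 - n ([sum_cube_min_le]), and therefore
alpha(S) >= n and xi(S) >= n.

If moreover all the m_j are equal to (1 - n) / (n + 1), the cube lies in n S, so
both bounds are attained, and the point of the cube where lambda_j is minimal
lies on the j-th facet of n S.  For S(t) the inverse matrix is explicit and
affine in t ([bary_table]); on 2/5 <= t <= 3/5 the signs of its entries do not
change and every m_j is -8/10 ([cube_min_S9]). *)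

(** * Minima of sets *)

Lemma minimum_unique (R : realType) (A : set R) (m : R) :
  A m -> lbound A m -> minimum A = m.
Proof.
move=> Am Alb; apply: xget_unique => // m' [Am' Alb'].
by apply/eqP; rewrite eq_le Alb // Alb'.
Qed.

(** * Barycentric coordinates *)

Definition vertex_mx (R : realType) (n : nat) (v : 'I_n.+1 -> 'rV[R]_n) :
    'M[R]_n.+1 :=
  \matrix_(i < n.+1, j < n.+1)
    (if unlift ord_max j is Some k then v i 0 k else 1).

(** Row [lift ord_max k] holds the coefficients of the k-th variable in the
barycentric coordinates, and row [ord_max] their constant terms. *)
Definition bary_mx (R : realType) (n : nat) (v : 'I_n.+1 -> 'rV[R]_n) :
    'M[R]_n.+1 :=
  invmx (vertex_mx v).

Definition bary (R : realType) (n : nat) (v : 'I_n.+1 -> 'rV[R]_n)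
    (x : 'rV[R]_n) (j : 'I_n.+1) : R :=
  \sum_k x 0 k * bary_mx v (lift ord_max k) j + bary_mx v ord_max j.

Lemma sum_ord_max (R : realType) (n : nat) (F : 'I_n.+1 -> R) :
  \sum_i F i = \sum_k F (lift ord_max k) + F ord_max.
Proof. by rewrite (bigD1_ord ord_max) //= addrC. Qed.

Lemma vertex_mx_lift (R : realType) (n : nat) (v : 'I_n.+1 -> 'rV[R]_n) i k :
  vertex_mx v i (lift ord_max k) = v i 0 k.
Proof. by rewrite mxE liftK. Qed.

Lemma vertex_mx_max (R : realType) (n : nat) (v : 'I_n.+1 -> 'rV[R]_n) i :
  vertex_mx v i ord_max = 1.
Proof. by rewrite mxE unlift_none. Qed.

(** A row vector killed by the vertex matrix is exactly an affine dependence
between the vertices: the last column gives the vanishing sum of weights. *)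
Lemma nondegenerate_unitmx (R : realType) (n : nat)
    (v : 'I_n.+1 -> 'rV[R]_n) :
  nondegenerate_simplex v <-> vertex_mx v \in unitmx.
Proof.
split=> [nd|uA l l0 lv0].
  rewrite unitmxE unitfE; apply/det0P => -[u u0 uA].
  case/eqP: u0; apply/rowP => j; rewrite [RHS]mxE.
  apply: nd (fun i => u 0 i) _ _ j.
    have /rowP/(_ ord_max) := uA; rewrite !mxE => e; rewrite -{}[RHS]e.
    by apply: eq_bigr => i _; rewrite vertex_mx_max mulr1.
  apply/rowP => k; have /rowP/(_ (lift ord_max k)) := uA.
  rewrite [RHS]mxE => e; rewrite [RHS]mxE -{}[RHS]e mxE summxE.
  by apply: eq_bigr => i _; rewrite vertex_mx_lift mxE.
have lA : (\row_i l i) *m vertex_mx v = 0.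
  apply/rowP => j; rewrite mxE [RHS]mxE.
  case: (unliftP ord_max j) => [k|] ->.
    have /rowP/(_ k) := lv0; rewrite [RHS]mxE summxE => e; rewrite -[RHS]e.
    by apply: eq_bigr => i _; rewrite vertex_mx_lift !mxE.
  rewrite -[RHS]l0; apply: eq_bigr => i _.
  by rewrite vertex_mx_max mxE mulr1.
move=> j; have := mulmxK uA (\row_i l i).
by rewrite lA mul0mx => /rowP/(_ j); rewrite !mxE.
Qed.

Lemma volume_neq0 (R : realType) (n : nat) (v : 'I_n.+1 -> 'rV[R]_n) :
  nondegenerate_simplex v -> volume v != 0.
Proof.
move=> /nondegenerate_unitmx; rewrite unitmxE unitfE => d0.
by rewrite mulf_neq0 ?normr_eq0 // invr_eq0 pnatr_eq0 -lt0n fact_gt0.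
Qed.

(** Barycentric coordinates are affine; the difference form is the one in which
homotheties and translations occur. *)
Lemma bary_homothety (R : realType) (n : nat) (v : 'I_n.+1 -> 'rV[R]_n)
    (p c u : 'rV[R]_n) (s : R) j :
  bary v (p + s *: (u - c)) j = bary v p j + s * (bary v u j - bary v c j).
Proof.
rewrite /bary [X in s * X](_ : _ =
  \sum_k (u 0 k - c 0 k) * bary_mx v (lift ord_max k) j); last first.
  rewrite opprD addrACA subrr addr0 -sumrB.
  by apply: eq_bigr => k _; rewrite mulrBl.
rewrite mulr_sumr addrAC -big_split /=; congr (_ + _).
by apply: eq_bigr => k _; rewrite !mxE mulrDl mulrA.
Qed.

(** The next four lemmas are the entries of the identity
[invmx A *m A = 1%:M] for the vertex matrix [A]. *)
Lemma sum_bary_mx_lift (R : realType) (n : nat) (v : 'I_n.+1 -> 'rV[R]_n) k :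
  nondegenerate_simplex v -> \sum_j bary_mx v (lift ord_max k) j = 0.
Proof.
move=> /nondegenerate_unitmx/mulVmx/matrixP.
move=> /(_ (lift ord_max k) ord_max); rewrite !mxE.
rewrite eq_sym (negPf (neq_lift _ _)) mulr0n => e; rewrite -[RHS]e.
by apply: eq_bigr => j _; rewrite vertex_mx_max mulr1.
Qed.

Lemma sum_bary_mx_max (R : realType) (n : nat) (v : 'I_n.+1 -> 'rV[R]_n) :
  nondegenerate_simplex v -> \sum_j bary_mx v ord_max j = 1.
Proof.
move=> /nondegenerate_unitmx/mulVmx/matrixP/(_ ord_max ord_max); rewrite !mxE.
rewrite eqxx mulr1n => e; rewrite -[RHS]e.
by apply: eq_bigr => j _; rewrite vertex_mx_max mulr1.
Qed.

Lemma bary_mx_lift_vertex (R : realType) (n : nat) (v : 'I_n.+1 -> 'rV[R]_n)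
    k i :
  nondegenerate_simplex v ->
  \sum_j bary_mx v (lift ord_max k) j * v j 0 i = (k == i)%:R.
Proof.
move=> /nondegenerate_unitmx/mulVmx/matrixP.
move=> /(_ (lift ord_max k) (lift ord_max i)); rewrite !mxE.
rewrite (inj_eq lift_inj) => <-.
by apply: eq_bigr => j _; rewrite vertex_mx_lift.
Qed.

Lemma bary_mx_max_vertex (R : realType) (n : nat) (v : 'I_n.+1 -> 'rV[R]_n) i :
  nondegenerate_simplex v -> \sum_j bary_mx v ord_max j * v j 0 i = 0.
Proof.
move=> /nondegenerate_unitmx/mulVmx/matrixP/(_ ord_max (lift ord_max i)).
rewrite !mxE (negPf (neq_lift _ _)) mulr0n => e; rewrite -[RHS]e.
by apply: eq_bigr => j _; rewrite vertex_mx_lift.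
Qed.

Lemma sum_bary (R : realType) (n : nat) (v : 'I_n.+1 -> 'rV[R]_n) x :
  nondegenerate_simplex v -> \sum_j bary v x j = 1.
Proof.
move=> nd; rewrite big_split /= sum_bary_mx_max // exchange_big /=.
rewrite big1 ?add0r //.
by move=> k _; rewrite -mulr_sumr sum_bary_mx_lift // mulr0.
Qed.

Lemma bary_decomposition (R : realType) (n : nat) (v : 'I_n.+1 -> 'rV[R]_n) x :
  nondegenerate_simplex v -> x = \sum_j bary v x j *: v j.
Proof.
move=> nd; apply/rowP => i; rewrite summxE.
transitivity (\sum_j (\sum_k x 0 k * bary_mx v (lift ord_max k) j * v j 0 i
                      + bary_mx v ord_max j * v j 0 i)); last first.
  by apply: eq_bigr => j _; rewrite mxE mulrDl mulr_suml.
rewrite big_split /= bary_mx_max_vertex // addr0 exchange_big /=.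
under eq_bigr => k _.
  under eq_bigr => j _ do rewrite -mulrA.
  rewrite -mulr_sumr bary_mx_lift_vertex //.
  over.
rewrite (bigD1 i) //= big1 ?eqxx ?addr0 ?mulr1 // => k /negPf ->.
by rewrite mulr0.
Qed.

(** Two systems of weights of total 1 representing the same point differ by an
affine dependence. *)
Lemma bary_unique (R : realType) (n : nat) (v : 'I_n.+1 -> 'rV[R]_n)
    (l : 'I_n.+1 -> R) j :
  nondegenerate_simplex v -> \sum_i l i = 1 ->
  bary v (\sum_i l i *: v i) j = l j.
Proof.
move=> nd l1; set x := \sum_i _.
apply/eqP; rewrite -subr_eq0; apply/eqP.
apply: (nd (fun i => bary v x i - l i)).
  by rewrite sumrB sum_bary // l1 subrr.
under eq_bigr => i _ do rewrite scalerBl.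
by rewrite sumrB -bary_decomposition // subrr.
Qed.

Lemma simplexP (R : realType) (n : nat) (v : 'I_n.+1 -> 'rV[R]_n) x :
  nondegenerate_simplex v -> simplex v x <-> forall j, 0 <= bary v x j.
Proof.
move=> nd; split=> [[l [l0 l1 ->]] j|x0]; first by rewrite bary_unique.
by exists (bary v x); split; rewrite ?sum_bary //; exact: bary_decomposition.
Qed.

Lemma bary_centroid (R : realType) (n : nat) (v : 'I_n.+1 -> 'rV[R]_n) j :
  nondegenerate_simplex v -> bary v (centroid v) j = n.+1%:R^-1.
Proof.
move=> nd; rewrite /centroid scaler_sumr (bary_unique (l := fun=> _)) //.
by rewrite sumr_const card_ord -[LHS]mulr_natr mulVf ?pnatr_eq0.
Qed.

(** The homothety fixes the centroid, where every coordinate is 1 / (n + 1), and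
multiplies the deviation from this value by s. *)
Lemma dilateP (R : realType) (n : nat) (v : 'I_n.+1 -> 'rV[R]_n) (s : R) x :
  nondegenerate_simplex v -> 0 < s ->
  dilate s v x <-> forall j, (1 - s) / n.+1%:R <= bary v x j.
Proof.
move=> nd s0; split=> [[u /(simplexP _ nd) u0 <-] j|xb].
  rewrite bary_homothety bary_centroid //.
  have : 0 <= s * bary v u j by rewrite mulr_ge0 // ltW.
  by move: (_^-1) => h; rewrite mulrBr mulrBl mul1r; lra.
exists (centroid v + s^-1 *: (x - centroid v)); last first.
  rewrite /homothety addrAC subrr add0r scalerA divff ?lt0r_neq0 // scale1r.
  by rewrite addrC subrK.
apply/(simplexP _ nd) => j; rewrite bary_homothety bary_centroid //.
have -> : n.+1%:R^-1 + s^-1 * (bary v x j - n.+1%:R^-1) =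
          s^-1 * (bary v x j - (1 - s) / n.+1%:R).
  by field; rewrite nat1r pnatr_eq0 lt0r_neq0.
by apply: mulr_ge0; [rewrite invr_ge0 ltW | rewrite subr_ge0].
Qed.

(** * Minima of the barycentric coordinates over the cube *)

Definition cube_min (R : realType) (n : nat) (v : 'I_n.+1 -> 'rV[R]_n)
    (j : 'I_n.+1) : R :=
  \sum_k Num.min (bary_mx v (lift ord_max k) j) 0 + bary_mx v ord_max j.

Definition cube_argmin (R : realType) (n : nat) (v : 'I_n.+1 -> 'rV[R]_n)
    (j : 'I_n.+1) : 'rV[R]_n :=
  \row_k (bary_mx v (lift ord_max k) j < 0)%R%:R.

Lemma cube_argmin_cube (R : realType) (n : nat) (v : 'I_n.+1 -> 'rV[R]_n) j :
  @cube R n (cube_argmin v j).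
Proof. by move=> i; rewrite mxE; case: (_ < 0); rewrite ?lexx ?ler01. Qed.

Lemma bary_cube_argmin (R : realType) (n : nat) (v : 'I_n.+1 -> 'rV[R]_n) j :
  bary v (cube_argmin v j) j = cube_min v j.
Proof.
congr (_ + _); apply: eq_bigr => k _; rewrite mxE.
by case: (ltP _ 0) => _; rewrite ?mul1r ?mul0r.
Qed.

Lemma cube_min_le (R : realType) (n : nat) (v : 'I_n.+1 -> 'rV[R]_n) x j :
  @cube R n x -> cube_min v j <= bary v x j.
Proof.
move=> xQ; rewrite lerD2r; apply: ler_sum => k _.
have /andP[x0 x1] := xQ k; set b := bary_mx _ _ _.
by rewrite ge_min; case: (leP 0 b) => b0; apply/orP; [right|left]; nra.
Qed.

Lemma cube_sub_dilateP (R : realType) (n : nat) (v : 'I_n.+1 -> 'rV[R]_n)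
    (s : R) :
  nondegenerate_simplex v -> 0 < s ->
  @cube R n `<=` dilate s v <->
  forall j, (1 - s) / n.+1%:R <= cube_min v j.
Proof.
move=> nd s0; split=> [sub j|mb x xQ].
  rewrite -bary_cube_argmin; move: j (cube_argmin_cube v j) => j /sub.
  by move=> /(dilateP _ nd s0).
by apply/(dilateP _ nd s0) => j; apply: le_trans (mb j) (cube_min_le _ _ _).
Qed.

Lemma vertex_simplex (R : realType) (n : nat) (v : 'I_n.+1 -> 'rV[R]_n) i :
  simplex v (v i).
Proof.
exists (fun j => (j == i)%:R); split.
- by move=> j; exact: ler0n.
- by rewrite (bigD1 i) //= big1 ?eqxx ?addr0 // => j /negPf ->.
- rewrite (bigD1 i) //= big1 ?eqxx ?addr0 ?scale1r // => j /negPf ->.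
  by rewrite scale0r.
Qed.

(** For each variable, the coefficients b_j of the barycentric coordinates sum
to 0 and their products with the vertex coordinates, which lie between 0 and 1,
sum to 1.  As min(b, 0) <= b - b x for 0 <= x <= 1, the sum of the min(b_j, 0)
is at most -1. *)
Lemma sum_cube_min_le (R : realType) (n : nat) (v : 'I_n.+1 -> 'rV[R]_n) :
  nondegenerate_simplex v -> simplex v `<=` @cube R n ->
  \sum_j cube_min v j <= 1 - n%:R.
Proof.
move=> nd vQ; rewrite big_split /= sum_bary_mx_max // addrC lerD2l.
rewrite exchange_big /= -[X in - X%:R]card_ord -sum1_card natr_sum -sumrN.
apply: ler_sum => k _.
have := bary_mx_lift_vertex k k nd; rewrite eqxx => e; rewrite -{}e.
rewrite -sumrN -[leRHS]add0r -[X in X + _](sum_bary_mx_lift k nd) -big_split /=.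
apply: ler_sum => j _; set b := bary_mx _ _ _.
have /andP[x0 x1] := vQ _ (vertex_simplex v j) k.
by rewrite ge_min; case: (leP 0 b) => b0; apply/orP; [right|left]; nra.
Qed.

(** A translate of s S is bounded by parallels to the facets of S, that is, by
lower bounds on the coordinates; these have total 1 - s wherever the translate
lies, and the total of the minima over the cube is at most 1 - n. *)
Lemma translate_dilate_cube_ge (R : realType) (n : nat)
    (v : 'I_n.+1 -> 'rV[R]_n) (s : R) (y : 'rV[R]_n) :
  nondegenerate_simplex v -> simplex v `<=` @cube R n -> 0 < s ->
  @cube R n `<=` [set y + x | x in dilate s v] -> n%:R <= s.
Proof.
move=> nd vQ s0 Qsub.
(* The left-hand side is the value on the translated j-th facet, where the
   coordinate of the point u of the original simplex is 0. *)
have mb j : bary v (y + centroid v) j - s * n.+1%:R^-1 <= cube_min v j.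
  rewrite -bary_cube_argmin.
  have [_ [u /(simplexP _ nd) u0 <-] <-] := Qsub _ (cube_argmin_cube v j).
  rewrite /homothety addrA bary_homothety bary_centroid //.
  have : 0 <= s * bary v u j by rewrite mulr_ge0 // ltW.
  by move: (_^-1) => h; rewrite mulrBr; lra.
have /le_trans/(_ (sum_cube_min_le nd vQ)) :=
  ler_sum (index_enum 'I_n.+1) (fun j (_ : true) => mb j).
rewrite sumrB sum_bary // sumr_const card_ord -[X in _ - X <= _]mulr_natr.
by rewrite mulfVK ?pnatr_eq0 //; lra.
Qed.

Lemma dilate_cube_ge (R : realType) (n : nat) (v : 'I_n.+1 -> 'rV[R]_n)
    (s : R) :
  nondegenerate_simplex v -> simplex v `<=` @cube R n -> 0 < s ->
  @cube R n `<=` dilate s v -> n%:R <= s.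
Proof.
move=> nd vQ s0 Qsub; apply: (translate_dilate_cube_ge (y := 0) nd vQ s0).
by move=> x /Qsub xs; exists x => //; rewrite add0r.
Qed.

(** The set defining [xi v] has a least element, namely the maximum of 1 and the
finitely many lower bounds imposed by the coordinates; so [xi v] is not the
default value of [minimum]. *)
Lemma xi_attained (R : realType) (n : nat) (v : 'I_n.+1 -> 'rV[R]_n) :
  nondegenerate_simplex v ->
  1 <= xi v /\ @cube R n `<=` dilate (xi v) v.
Proof.
move=> nd; pose m := \big[Num.max/1]_j (1 - n.+1%:R * cube_min v j).
have n0 : 0 < n.+1%:R :> R by rewrite ltr0n.
have boundP s j : ((1 - s) / n.+1%:R <= cube_min v j) =
                  (1 - n.+1%:R * cube_min v j <= s).
  by rewrite ler_pdivrMr // mulrC; apply/idP/idP; lra.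
have mP : 1 <= m /\ @cube R n `<=` dilate m v.
  have m1 : 1 <= m by exact: bigmax_ge_id.
  split=> //; apply/cube_sub_dilateP => //; first lra.
  by move=> j; rewrite boundP; exact: le_bigmax.
suff -> : xi v = m by [].
apply: minimum_unique => // s [s1 /cube_sub_dilateP-/(_ nd) H].
apply: bigmax_le => // j _.
by rewrite -boundP; apply: H; lra.
Qed.

Lemma xi_ge (R : realType) (n : nat) (v : 'I_n.+1 -> 'rV[R]_n) :
  nondegenerate_simplex v -> simplex v `<=` @cube R n -> n%:R <= xi v.
Proof.
move=> nd vQ; have [x1 xQ] := xi_attained nd.
by apply: dilate_cube_ge xQ => //; lra.
Qed.

(** * Simplices whose coordinates have equal minima over the cube *)

Lemma xi_equal_minima (R : realType) (n : nat) (v : 'I_n.+1 -> 'rV[R]_n) :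
  (0 < n)%N -> nondegenerate_simplex v -> simplex v `<=` @cube R n ->
  (forall j, cube_min v j = (1 - n%:R) / n.+1%:R) -> xi v = n%:R.
Proof.
move=> n0 nd vQ mE; apply: minimum_unique.
  split; first by rewrite ler1n.
  by apply/cube_sub_dilateP; rewrite ?ltr0n // => j; rewrite mE.
by move=> s [s1]; apply: dilate_cube_ge => //; lra.
Qed.

Lemma alpha_equal_minima (R : realType) (n : nat) (v : 'I_n.+1 -> 'rV[R]_n) :
  (0 < n)%N -> nondegenerate_simplex v -> simplex v `<=` @cube R n ->
  (forall j, cube_min v j = (1 - n%:R) / n.+1%:R) -> alpha v = n%:R.
Proof.
move=> n0 nd vQ mE; apply: minimum_unique.
  split; first by rewrite ltr0n.
  exists 0 => x xQ; exists x; rewrite ?add0r //.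
  have nR0 : 0 < n%:R :> R by rewrite ltr0n.
  by apply: (cube_sub_dilateP nd nR0).2 xQ => j; rewrite mE.
by move=> s [s0 [y]]; exact: translate_dilate_cube_ge.
Qed.

Lemma homothety_combination (R : realType) (n : nat)
    (v : 'I_n.+1 -> 'rV[R]_n) (c : 'rV[R]_n) (s : R) (l : 'I_n.+1 -> R) :
  \sum_j l j *: homothety c s (v j) =
  (\sum_j l j) *: c + s *: (\sum_j l j *: v j - (\sum_j l j) *: c).
Proof.
rewrite !scaler_suml -sumrB scaler_sumr -big_split /=.
apply: eq_bigr => j _.
by rewrite scalerDr -scalerBr !scalerA mulrC.
Qed.

Lemma dilate_simplex (R : realType) (n : nat) (v : 'I_n.+1 -> 'rV[R]_n)
    (s : R) :
  dilate s v = simplex (fun j => homothety (centroid v) s (v j)).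
Proof.
apply/seteqP; split=> [_ [_ [l [l0 l1 ->]] <-]|_ [l [l0 l1 ->]]].
  by exists l; split=> //; rewrite homothety_combination l1 scale1r.
exists (\sum_j l j *: v j); first by exists l.
by rewrite homothety_combination l1 scale1r.
Qed.

(** The point of the cube where the i-th coordinate of S is minimal has i-th
coordinate zero with respect to the dilated simplex. *)
Lemma circumscribed_equal_minima (R : realType) (n : nat)
    (v : 'I_n.+1 -> 'rV[R]_n) (s : R) :
  0 < s -> nondegenerate_simplex v ->
  (forall j, cube_min v j = (1 - s) / n.+1%:R) ->
  circumscribed (dilate s v) (@cube R n).
Proof.
move=> s0 nd mE; exists (fun j => homothety (centroid v) s (v j)).
have Qsub : @cube R n `<=` dilate s v.
  by apply/cube_sub_dilateP => // j; rewrite mE.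
split=> //; first 2 last.
- move=> i; exists (cube_argmin v i); split; last exact: cube_argmin_cube.
  have := Qsub _ (cube_argmin_cube v i); rewrite dilate_simplex.
  move=> [l [l0 l1 xE]]; exists l; split=> //.
  have := mE i; rewrite -bary_cube_argmin xE homothety_combination l1 scale1r.
  rewrite bary_homothety bary_centroid // bary_unique //.
  rewrite mulrBr mulrBl mul1r; move: (_^-1) => h e.
  have /eqP : s * l i = 0 by lra.
  by rewrite mulf_eq0 gt_eqF //= => /eqP.
- move=> l l0; rewrite homothety_combination l0 scale0r add0r subr0 => /eqP.
  by rewrite scaler_eq0 gt_eqF //= => /eqP lv; exact: nd.
- exact: dilate_simplex.
Qed.

(** * The simplices S(t) *)

(** Five times the inverse of the vertex matrix of S(t). *)
Definition bary_table (R : realType) (t : R) : seq (seq R) :=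
  [::
      [:: 3 - 5 * t; 1; 2; 0; -1; -3; 1; -1; 0; 5 * t - 2];
      [:: 5 * t - 3; 1; -1; 3; 0; -1; 1; 0; -2; 2 - 5 * t];
      [:: 2 - 5 * t; -1; 3; 0; 1; -2; -1; 1; 0; 5 * t - 3];
      [:: 5 * t - 3; 3; 0; 1; -1; 0; -2; -1; 1; 2 - 5 * t];
      [:: -5; 0; 0; 0; 0; 0; 0; 0; 0; 5];
      [:: 2 - 5 * t; 1; -1; -2; 0; -1; 1; 0; 3; 5 * t - 3];
      [:: 5 * t - 3; 0; 1; -1; -2; 1; 0; 3; -1; 2 - 5 * t];
      [:: 2 - 5 * t; -2; 0; 1; -1; 0; 3; -1; 1; 5 * t - 3];
      [:: 5 * t - 2; 0; -1; 1; -3; -1; 0; 2; 1; 3 - 5 * t];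
      [:: 4; -1; -1; -1; 4; 4; -1; -1; -1; -1]].

Lemma bary_table_correct (R : realType) (t : R) :
  vertex_mx (S9 t) *m
    (\matrix_(i < 10, j < 10) (nth 0 (nth [::] (bary_table t) i) j / 5)) =
  1%:M.
Proof.
apply/matrixP => i j; rewrite !mxE sum_ord_max vertex_mx_max mul1r.
under eq_bigr => k _ do rewrite vertex_mx_lift mxE mxE lift_max.
rewrite !big_ord_recl big_ord0 mxE /=.
case: i => i /= ilt; case: j => j /= jlt; rewrite -val_eqE /=.
do 10 (destruct i as [|i]; first by
  (do 10 (destruct j as [|j]; first by [rewrite /=; field])); move: jlt).
by move: ilt.
Qed.

Lemma nondegenerate_S9 (R : realType) (t : R) : nondegenerate_simplex (S9 t).
Proof.
by have [uA _] := mulmx1_unit (bary_table_correct t); exact/nondegenerate_unitmx.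
Qed.

Lemma bary_mx_S9 (R : realType) (t : R) i j :
  bary_mx (S9 t) i j = nth 0 (nth [::] (bary_table t) i) j / 5.
Proof.
have [uA _] := mulmx1_unit (bary_table_correct t).
by rewrite /bary_mx -[invmx _]mulmx1 -(bary_table_correct t) mulKmx // mxE.
Qed.

(** Column by column, the hypothesis on t decides the sign of each table entry,
so that the minimum with 0 is either the entry or 0. *)
Lemma cube_min_S9 (R : realType) (t : R) j :
  2 / 5 <= t <= 3 / 5 -> cube_min (S9 t) j = (1 - 9) / 10.
Proof.
move=> /andP[t1 t2]; rewrite /cube_min bary_mx_S9.
under eq_bigr => k _ do rewrite bary_mx_S9 lift_max.
rewrite !big_ord_recl big_ord0.
case: j => j /= jlt.
do 10 (destruct j as [|j]; first by
  (rewrite /=;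
   repeat match goal with |- context [Num.min ?a 0] =>
     first [rewrite (min_idPl (_ : a <= 0)); last lra
           |rewrite (min_idPr (_ : 0 <= a)); last lra] end; lra)).
by move: jlt.
Qed.

Lemma S9_sub_cube (R : realType) (t : R) :
  0 <= t <= 1 -> simplex (S9 t) `<=` @cube R 9.
Proof.
move=> /andP[t0 t1].
have vQ i k : 0 <= S9 t i 0 k <= 1.
  rewrite mxE; case: i => i /= ilt; case: k => k /= klt.
  do 10 (destruct i as [|i]; first by
    (do 9 (destruct k as [|k]; first by [rewrite /=; lra])); move: klt).
  by move: ilt.
move=> _ [l [l0 l1 ->]] k; rewrite summxE; apply/andP; split.
  apply: sumr_ge0 => j _; rewrite mxE mulr_ge0 //.
  by have /andP[] := vQ j k.
rewrite -l1; apply: ler_sum => j _; rewrite mxE -[leRHS]mulr1.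
by rewrite ler_wpM2l //; have /andP[] := vQ j k.
Qed.

Theorem mainTheorem5 (R : realType) :
  (forall t : R, 2 / 5 <= t <= 3 / 5 ->
     [/\ nondegenerate_simplex (S9 t),
         simplex (S9 t) `<=` @cube R 9,
         alpha (S9 t) = 9 /\ xi (S9 t) = 9
       & circumscribed (dilate 9 (S9 t)) (@cube R 9)]) /\
  xi_min R 9 = 9.
Proof.
have S9P (t : R) : 2 / 5 <= t <= 3 / 5 ->
    [/\ nondegenerate_simplex (S9 t), simplex (S9 t) `<=` @cube R 9,
      alpha (S9 t) = 9 /\ xi (S9 t) = 9
    & circumscribed (dilate 9 (S9 t)) (@cube R 9)].
  move=> tI; have nd := @nondegenerate_S9 R t.
  have SQ : simplex (S9 t) `<=` @cube R 9 by apply: S9_sub_cube; lra.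
  have mE j := cube_min_S9 j tI.
  split=> //; last exact: circumscribed_equal_minima.
  by split; [exact: alpha_equal_minima | exact: xi_equal_minima].
split=> //; apply: minimum_unique.
  (* Any t between 2/5 and 3/5 gives a simplex attaining the bound. *)
  have [|nd SQ [_ xi9] _] := S9P (2^-1); first lra.
  by exists (S9 2^-1) => //; split=> //; exact: volume_neq0.
by move=> _ [v [nd vQ _] <-]; exact: xi_ge.
Qed.
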